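(* Let $k,n$ be integers with $2\le k\le n$. For every graph $G$ on $n$ vertices, $$\lambda_k(G)\;\le\;\frac{\gamma(k-1)}{2(k-1)}\,n-1\;\le\;\frac{(k-2)\sqrt{k+1}+2}{2k(k-1)}\,n-1.$$ In particular, for every integer $k\ge 2$, $c_k\le \dfrac{(k-2)\sqrt{k+1}+2}{2k(k-1)}$.
   Context: Graphs are finite, simple and undirected. For a graph $G$ on $n$ vertices, $\lambda_1(G)\ge\lambda_2(G)\ge\cdots\ge\lambda_n(G)$ are the eigenvalues of its adjacency matrix, counted with multiplicity. For an integer $k\ge 2$, $c_k:=\sup\{\lambda_k(G)/|V(G)| : G \text{ a graph with } |V(G)|\ge k\}$. For integers $N\ge r\ge 1$, let $\mathcal{P}_r(N):=\{Q\in\mathbb{R}^{N\times N}: Q=Q^\top=Q^2,\ \operatorname{rank}(Q)=r\}$ be the set of rank-$r$ orthogonal projections, and for $Q=(q_{ij})$ let $\|Q\|_1:=\sum_{i,j=1}^N|q_{ij}|$. Set $\gamma(N,r):=\frac1N\max_{Q\in\mathcal{P}_r(N)}\|Q\|_1$ and $\gamma(r):=\sup_{N\ge r}\gamma(N,r)$ (the absolute projection constant in dimension $r$). *)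

(* Defs.v *)
From HB Require Import structures.
From mathcomp Require Import all_boot all_order all_algebra.
From mathcomp Require Import polyrcf complex.
From mathcomp Require Import ring.
From mathcomp Require Import all_classical all_reals.

Set Implicit Arguments.
Unset Strict Implicit.
Unset Printing Implicit Defensive.

Import Order.TTheory GRing.Theory Num.Theory.

Local Open Scope classical_set_scope.
Local Open Scope ring_scope.

Record sgraph := SGraph {
  vertex :> finType;
  edge : rel vertex;
  edge_sym : symmetric edge;
  edge_irrefl : irreflexive edge }.

Definition adjmx (R : realType) (G : sgraph) : 'M[R]_#|G| :=
  \matrix_(i, j) (edge (enum_val i) (enum_val j))%:R.

(* [rootsR] lists each real root of the characteristic polynomial once; each is
   repeated here according to its multiplicity.  For a symmetric [A] this is
   the full spectrum: see [eigenvaluesP] and [size_eigenvalues]. *)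
Definition eigenvalues (R : realType) (n : nat) (A : 'M[R]_n) : seq R :=
  sort >=%R
    (flatten [seq nseq (mup x (char_poly A)) x | x <- rootsR (char_poly A)]).

(* The k-th largest eigenvalue counted from k = 1; meaningful for
   [1 <= k <= #|G|]. *)
Definition lambda (R : realType) (k : nat) (G : sgraph) : R :=
  (eigenvalues (adjmx R G))`_k.-1.

(* [sup] is 0 on unbounded sets; see [c_has_sup], [gammaN_has_sup] and
   [gamma_has_sup] for the suprema below. *)
Definition c_ (R : realType) (k : nat) : R :=
  sup [set x | exists G : sgraph, (k <= #|G|)%N /\ x = lambda R k G / #|G|%:R].

Definition orthoproj (R : realType) (r N : nat) : set 'M[R]_N :=
  [set Q | [/\ Q^T = Q, Q *m Q = Q & \rank Q = r]].
Arguments orthoproj : clear implicits.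

Definition norm1 (R : realType) (N : nat) (Q : 'M[R]_N) : R :=
  \sum_i \sum_j `|Q i j|.

(* For [1 <= r <= N], [orthoproj R r N] is nonempty and compact, so the supremum
   is a maximum. *)
Definition gammaN (R : realType) (N r : nat) : R :=
  N%:R^-1 * sup [set norm1 Q | Q in orthoproj R r N].

Definition gamma (R : realType) (r : nat) : R :=
  sup [set gammaN R N r | N in [set N | (r <= N)%N]].

Lemma char_poly_sym_split (R : realType) (n : nat) (A : 'M[R]_n) :
  A^T = A -> exists s : seq R, char_poly A = \prod_(x <- s) ('X - x%:P).
Proof.
move=> Asym; pose f : {rmorphism R -> R[i]} := real_complex R.
have fconj x : ((f x)^* = f x)%R.
  by apply/conj_Creal/complex_realP; exists x.
pose B := map_mx f A.
have BH : B \is hermsymmx.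
  apply/is_hermitianmxP; rewrite expr0 scale1r.
  by apply/matrixP => i j; rewrite !mxE fconj -{1}Asym mxE.
have /orthomx_spectralP := hermitian_normalmx BH.
set P := spectralmx B; set d := spectral_diag B => BE.
have Pu : P \in unitmx by exact: spectral_unit.
have dR j : exists x, d 0 j = f x.
  have /mxOverP/(_ 0 j) := hermitian_spectral_diag_real BH.
  by move/complex_realP => [x ->]; exists x.
pose g j := projT1 (cid (dR j)).
have gE j : d 0 j = f (g j) by rewrite /g; case: cid.
have cB : char_poly B = char_poly (diag_mx d).
  rewrite BE /char_poly /char_poly_mx !map_mxM /= !map_invmx /=.
  set Q := map_mx polyC P.
  have Qu : Q \in unitmx by rewrite map_unitmx.
  have -> : 'X%:M - invmx Q *m map_mx polyC (diag_mx d) *m Q =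
     invmx Q *m ('X%:M - map_mx polyC (diag_mx d)) *m Q.
    by rewrite mulmxBr mulmxBl scalar_mxC -!mulmxA mulVmx ?mulmx1.
  by rewrite !det_mulmx mulrAC -det_mulmx mulVmx // det1 mul1r.
exists [seq g j | j <- enum 'I_n].
apply: (map_poly_inj f); rewrite map_char_poly -/B cB.
rewrite char_poly_trig ?diag_mx_is_trig // big_map big_enum rmorph_prod /=.
by apply: eq_bigr => i _; rewrite mxE eqxx mulr1n gE rmorphB /= map_polyX map_polyC.
Qed.

Lemma eigenvaluesP (R : realType) (n : nat) (A : 'M[R]_n) :
  A^T = A -> char_poly A = \prod_(x <- eigenvalues A) ('X - x%:P).
Proof.
move=> /char_poly_sym_split [s sE]; rewrite {1}sE; apply: perm_big.
rewrite perm_sym perm_sort.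
have p0 : char_poly A != 0 by rewrite monic_neq0 // char_poly_monic.
have mE x : mup x (char_poly A) = count_mem x s by rewrite sE mu_prod_XsubC.
apply/allP => y _ /=; rewrite -mE count_flatten -map_comp sumnE big_map.
under eq_bigr do rewrite /= count_nseq /=.
have rE : (y \in rootsR (char_poly A)) = root (char_poly A) y.
  by rewrite -[RHS]andTb -(roots_on_rootsR p0).
have ru : uniq (rootsR (char_poly A)) by exact: uniq_roots.
rewrite (eq_bigr (fun x => if x == y then mup y (char_poly A) else 0)%N); last first.
  by move=> x _; case: eqP => [->|]; rewrite ?mul1n.
rewrite -big_mkcond /=; case: (boolP (root (char_poly A) y)) => yr.
  by rewrite -big_filter filter_pred1_uniq ?rE // big_seq1.
by rewrite mupNroot // big1.
Qed.

Lemma eigenvalues_sorted (R : realType) (n : nat) (A : 'M[R]_n) :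
  sorted >=%R (eigenvalues A).
Proof. by apply: sort_sorted => x y; exact: le_total. Qed.

Lemma size_eigenvalues (R : realType) (n : nat) (A : 'M[R]_n) :
  A^T = A -> size (eigenvalues A) = n.
Proof.
move=> /eigenvaluesP /(congr1 (fun p : {poly R} => size p)).
by rewrite size_char_poly size_prod_XsubC => -[].
Qed.

Lemma adjmx_sym (R : realType) (G : sgraph) : (adjmx R G)^T = adjmx R G.
Proof. by apply/matrixP => i j; rewrite !mxE edge_sym. Qed.

Lemma lambda_le (R : realType) (k : nat) (G : sgraph) :
  lambda R k G <= #|G|%:R.
Proof.
have [kl|kl] := ltnP k.-1 (size (eigenvalues (adjmx R G))); last first.
  by rewrite /lambda nth_default ?ler0n.
set l := lambda R k G.
have : root (char_poly (adjmx R G)) l.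
  rewrite (eigenvaluesP (adjmx_sym R G)) root_prod_XsubC; exact: mem_nth.
rewrite -eigenvalue_root_char => /eigenvalueP [v vA v0].
have S0 : 0 < \sum_j `|v 0 j|.
  rewrite lt_def sumr_ge0 ?andbT => [|j _]; last exact: normr_ge0.
  apply: contra v0; rewrite psumr_eq0 => [/allP h|j _]; last exact: normr_ge0.
  by apply/eqP/rowP => j; rewrite mxE; apply/eqP;
  rewrite -normr_eq0; have := h j; rewrite mem_index_enum => /(_ isT).
apply: le_trans (ler_norm l) _; rewrite -(ler_pM2r S0) mulr_sumr.
rewrite mulr_natl -[leRHS](_ : \sum_(j < #|G|) \sum_i `|v 0 i| = _); last first.
  by rewrite sumr_const card_ord.
apply: ler_sum => j _; rewrite -normrM.
have -> : l * v 0 j = (v *m adjmx R G) 0 j by rewrite vA mxE.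
rewrite mxE; apply: le_trans (ler_norm_sum _ _ _) _; apply: ler_sum => i _.
by rewrite mxE normrM normr_nat ler_piMr // lern1 leq_b1.
Qed.

Lemma c_has_sup (R : realType) (k : nat) :
  has_sup [set x | exists G : sgraph, (k <= #|G|)%N /\ x = lambda R k G / #|G|%:R].
Proof.
split.
  have sy : symmetric (fun _ _ : 'I_k => false) by [].
  have ir : irreflexive (fun _ _ : 'I_k => false) by [].
  exists (lambda R k (SGraph sy ir) / #|SGraph sy ir|%:R).
  by exists (SGraph sy ir); rewrite card_ord.
exists 1 => _ [G [_ ->]].
have [->|G0] := posnP #|G|; first by rewrite invr0 mulr0.
by rewrite ler_pdivrMr ?ltr0n // mul1r lambda_le.
Qed.

Lemma mxtrace_orthoproj (R : realType) (r N : nat) (Q : 'M[R]_N) :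
  orthoproj R r N Q -> \tr Q = r%:R.
Proof.
case=> _ QQ <-.
have h : row_base Q *m col_base Q = 1%:M.
  have [C CE] := row_freeP (row_base_free Q).
  have [D DE] := row_fullP (col_base_full Q).
  move: (row_base Q) (col_base Q) C D CE DE (mulmx_base Q).
  move: (\rank Q) => m U V C D CE DE VU.
  have : D *m (Q *m Q) *m C = D *m Q *m C by rewrite QQ.
  rewrite -{}VU -[in RHS]mulmxA -[in RHS]mulmxA CE mulmx1 DE => <-.
  by rewrite !mulmxA DE mul1mx -!mulmxA CE mulmx1.
by rewrite -{1}(mulmx_base Q) mxtrace_mulC h mxtrace1.
Qed.

Lemma norm1_orthoproj_le (R : realType) (r N : nat) (Q : 'M[R]_N) :
  orthoproj R r N Q -> norm1 Q <= N%:R * (r%:R + 1).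
Proof.
move=> Qr; have [Qs QQ _] := Qr.
have trE : \sum_i \sum_j Q i j ^+ 2 = r%:R.
  rewrite -(mxtrace_orthoproj Qr) -{2}QQ; apply: eq_bigr => i _.
  by rewrite mxE; apply: eq_bigr => j _; rewrite expr2 -{2}Qs mxE.
case: N Q Qr Qs QQ trE => [|N] Q Qr Qs QQ trE.
  by rewrite /norm1 big_ord0 mul0r.
have N0 : 0 < N.+1%:R :> R by rewrite ltr0n.
rewrite -(ler_pM2l N0) mulrDr mulr1 mulrDr -trE !mulr_sumr.
have -> : N.+1%:R * N.+1%:R = \sum_(i < N.+1) \sum_(j < N.+1) 1 :> R.
  by rewrite !sumr_const !card_ord mulr_natl.
rewrite -big_split; apply: ler_sum => i _ /=.
rewrite !mulr_sumr -big_split; apply: ler_sum => j _ /=.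
rewrite -(real_normK (num_real (Q i j))).
set t := `|_|; rewrite mulrA -expr2 -exprMn.
rewrite -subr_ge0 [leRHS](_ : _ = (N.+1%:R * t - 2^-1) ^+ 2 + 3 / 4); last by field.
by rewrite addr_ge0 ?sqr_ge0 // divr_ge0.
Qed.

Lemma gammaN_has_sup (R : realType) (N r : nat) :
  (r <= N)%N -> has_sup [set norm1 Q | Q in orthoproj R r N].
Proof.
move=> rN; split; last first.
  by exists (N%:R * (r%:R + 1)) => _ [Q Qr <-]; exact: norm1_orthoproj_le.
exists (norm1 (pid_mx r : 'M[R]_N)), (pid_mx r) => //; split.
- exact: tr_pid_mx.
- by rewrite pid_mx_id.
- by rewrite rank_pid_mx ?rN.
Qed.

Lemma gamma_has_sup (R : realType) (r : nat) :
  has_sup [set gammaN R N r | N in [set N | (r <= N)%N]].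
Proof.
split; first by exists (gammaN R r r), r => /=.
exists (r%:R + 1) => _ [N /= rN <-].
have [->|N0] := posnP N; first by rewrite /gammaN invr0 mul0r addr_ge0.
rewrite /gammaN mulrC ler_pdivrMr ?ltr0n // mulrC.
apply: ge_sup; first by case: (gammaN_has_sup R rN).
by move=> _ [Q Qr <-]; exact: norm1_orthoproj_le.
Qed.

(* Main.v *)
Require Import Defs.
From mathcomp Require Import all_boot all_order all_algebra.
From mathcomp Require Import ring lra.
From mathcomp Require Import all_classical all_reals.
From mathcomp Require Import topology normedtype function_spaces derive.

Set Implicit Arguments.
Unset Strict Implicit.
Unset Printing Implicit Defensive.

Import Order.TTheory GRing.Theory Num.Theory.
Import numFieldNormedType.Exports.

Local Open Scope classical_set_scope.
Local Open Scope ring_scope.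

(** Write [r = k - 1] and [s = sqrt (r + 2)].

    The eigenvalue bound.  The top [r + 1] eigenvectors of the adjacency matrix
    [A] span a space on which its form is at least [lambda_k]; this space has an
    [r]-dimensional subspace orthogonal to the all-ones vector ([ky_fan_orth]).
    The projection [Q] on that subspace satisfies [r lambda_k <= tr (A Q)], and
    its entries sum to zero, so the positive ones sum to half of [|Q|_1].  Since
    [A] is a 0-1 matrix with zero diagonal, [tr (A Q)] is at most this half
    minus [tr Q = r] ([lambda_le_norm1]).

    The bound on the projection constant.  Consider the functional
    [sum_ij t_i t_j |Q_ij|] of a unit vector [t >= 0] and a projection [Q] of
    rank at most [r].  At the uniform [t] it is [|Q|_1 / N], and by compactness
    it has a maximum [g], at some pair [(t, Q)] ([extremal_pair]).  Maximality
    in [t] makes [t] an eigenvector of the matrix of the [|Q_ij|]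
    ([rayleigh_max]).  With [M_ij = t_i t_j sgn Q_ij], maximality in [Q] makes
    [Q] commute with [M], and [M] positive semidefinite on the range of [Q]
    ([ky_fan_max]).  Hence [K = M Q] is a Gram matrix of vectors in the range of
    [Q], with [K_ii = g t_i ^ 2] and
    [tr (K K) = tr (M K) <= sum_ij t_i t_j |K_ij|].

    Put [c_ij = K_ij / (g t_i t_j)], the cosines of a system of vectors to which
    the weights [t_i ^ 2] are attached.  The absolute value [|c_ij|] is at most
    a combination of [1], [c_ij ^ 2] and [- c_ij ^ 4] ([quartic_majorant]), and
    the weighted fourth moment of the [c_ij] is at least that of the uniform
    measure on the sphere, [3 / (r (r + 2))] ([fourth_moment_ge]).  Summing with
    weights leaves an inequality between [g] and [tr (K K)], which with
    [g ^ 2 <= r tr (K K)] (an equality if [r = 1]) gives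
    [g <= (s - 1) (s + 2) / (s + 1)]; this is the stated bound
    ([gramian_bound]). *)

(** * The Euclidean inner product *)

(** The Euclidean inner product of two row vectors. *)
Definition dotr (R : pzRingType) (n : nat) (u v : 'rV[R]_n) : R :=
  (u *m v^T) 0 0.

Lemma mulmx_dotr (R : pzRingType) (n : nat) (u v : 'rV[R]_n) :
  u *m v^T = (dotr u v)%:M.
Proof. exact: mx11_scalar. Qed.

Lemma dotrE (R : pzRingType) (n : nat) (u v : 'rV[R]_n) :
  dotr u v = \sum_i u 0 i * v 0 i.
Proof. by rewrite /dotr mxE; apply: eq_bigr => i _; rewrite mxE. Qed.

Lemma dotrC (R : comPzRingType) (n : nat) (u v : 'rV[R]_n) :
  dotr u v = dotr v u.
Proof. by rewrite !dotrE; apply: eq_bigr => i _; rewrite mulrC. Qed.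

Lemma dotrBl (R : pzRingType) (n : nat) (u v w : 'rV[R]_n) :
  dotr (u - v) w = dotr u w - dotr v w.
Proof. by rewrite /dotr mulmxBl !mxE. Qed.

Lemma dotr_ge0 (R : realDomainType) (n : nat) (u : 'rV[R]_n) : 0 <= dotr u u.
Proof. by rewrite dotrE sumr_ge0 // => i _; rewrite -expr2 sqr_ge0. Qed.

Lemma dotr_eq0 (R : realDomainType) (n : nat) (u : 'rV[R]_n) :
  (dotr u u == 0) = (u == 0).
Proof.
apply/idP/eqP => [|->]; last by rewrite /dotr mul0mx mxE.
rewrite dotrE psumr_eq0 => [/allP h|i _]; last by rewrite -expr2 sqr_ge0.
apply/rowP => i; rewrite mxE; apply/eqP.
by have := h i; rewrite mem_index_enum mulf_eq0 orbb => /(_ isT).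
Qed.

Lemma dotr_gt0 (R : realDomainType) (n : nat) (u : 'rV[R]_n) :
  (0 < dotr u u) = (u != 0).
Proof. by rewrite lt_def dotr_ge0 dotr_eq0 andbT. Qed.

Lemma dotrZ (R : comPzRingType) (n : nat) (c : R) (u : 'rV[R]_n) :
  dotr (c *: u) (c *: u) = c ^+ 2 * dotr u u.
Proof.
by rewrite !dotrE mulr_sumr; apply: eq_bigr => i _; rewrite !mxE mulrACA.
Qed.

Lemma dotr_delta (R : nzRingType) (n : nat) (i : 'I_n) :
  dotr (delta_mx 0 i) (delta_mx 0 i) = 1 :> R.
Proof.
rewrite dotrE (bigD1 i) //= big1 ?addr0 => [|j ji]; rewrite !mxE ?eqxx ?mulr1 //.
by rewrite (negPf ji) mulr0.
Qed.

Lemma dotrDl (R : pzRingType) (n : nat) (u v w : 'rV[R]_n) :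
  dotr (u + v) w = dotr u w + dotr v w.
Proof. by rewrite /dotr mulmxDl !mxE. Qed.

Lemma dotrDr (R : pzRingType) (n : nat) (u v w : 'rV[R]_n) :
  dotr u (v + w) = dotr u v + dotr u w.
Proof. by rewrite /dotr linearD mulmxDr !mxE. Qed.

Lemma dotrZl (R : pzRingType) (n : nat) (c : R) (u v : 'rV[R]_n) :
  dotr (c *: u) v = c * dotr u v.
Proof. by rewrite /dotr -scalemxAl !mxE. Qed.

Lemma dotrZr (R : comPzRingType) (n : nat) (c : R) (u v : 'rV[R]_n) :
  dotr u (c *: v) = c * dotr u v.
Proof. by rewrite dotrC dotrZl dotrC. Qed.

Lemma dotr_mulmx (R : comPzRingType) (n : nat) (M : 'M[R]_n) (u v : 'rV[R]_n) :
  dotr (u *m M) v = dotr u (v *m M^T).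
Proof. by rewrite /dotr trmx_mul trmxK mulmxA. Qed.

Lemma dotr_deltar (R : pzRingType) (n : nat) (u : 'rV[R]_n) (i : 'I_n) :
  dotr u (delta_mx 0 i) = u 0 i.
Proof.
rewrite dotrE (bigD1 i) //= big1 ?addr0 => [|j ji]; rewrite mxE.
  by rewrite !eqxx mulr1.
by rewrite eqxx (negPf ji) mulr0.
Qed.

Lemma dotr_cauchy_schwarz (R : realDomainType) (n : nat) (u v : 'rV[R]_n) :
  dotr u v ^+ 2 <= dotr u u * dotr v v.
Proof.
have [->|v0] := eqVneq v 0.
  by rewrite /dotr trmx0 !mulmx0 !mxE expr0n mulr0.
have := dotr_ge0 (dotr v v *: u - dotr u v *: v).
rewrite dotrBl !dotrZl ![dotr _ (_ - _)]dotrC !dotrBl !dotrZl (dotrC v u).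
have -> : dotr v v * (dotr v v * dotr u u - dotr u v * dotr u v) -
  dotr u v * (dotr v v * dotr u v - dotr u v * dotr v v) =
  dotr v v * (dotr u u * dotr v v - dotr u v ^+ 2) by ring.
by rewrite pmulr_rge0 ?dotr_gt0 // subr_ge0.
Qed.

Lemma dotr_row (R : pzRingType) (m m' n : nat) (X : 'M[R]_(m, n))
    (Y : 'M[R]_(m', n)) (i : 'I_m) (j : 'I_m') :
  dotr (row i X) (row j Y) = (X *m Y^T) i j.
Proof. by rewrite dotrE mxE; apply: eq_bigr => l _; rewrite !mxE. Qed.

(** * The real spectral theorem *)

(** Two vectors of equal length are exchanged by a Householder reflection. *)
Lemma householder (R : realFieldType) (n : nat) (u v : 'rV[R]_n) :
  dotr u u = dotr v v ->
  exists H : 'M[R]_n, [/\ H^T = H, H *m H = 1%:M & u *m H = v].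
Proof.
move=> uv; have [<-|uNv] := eqVneq u v.
  by exists 1%:M; rewrite trmx1 !mulmx1.
have [w wuv] : exists w, w = u - v by exists (u - v).
pose c := 2 / dotr w w.
have w0 : dotr w w != 0 by rewrite dotr_eq0 wuv subr_eq0.
have uw : dotr u w * c = 1.
  have wE : dotr w w = 2 * dotr u w.
    rewrite {1}wuv dotrBl ![dotr _ w]dotrC wuv !dotrBl -uv (dotrC v u); ring.
  rewrite /c wE; field; apply: contraNneq w0 => h.
  by rewrite wE h mulr0.
exists (1%:M - c *: (w^T *m w)); split.
- by rewrite linearB /= trmx1 linearZ /= trmx_mul trmxK.
- have wwww : (w^T *m w) *m (w^T *m w) = dotr w w *: (w^T *m w).
    by rewrite mulmxA -(mulmxA w^T w) mulmx_dotr mul_mx_scalar -scalemxAl.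
  rewrite mulmxBl mul1mx mulmxBr mulmx1 -scalemxAl -scalemxAr wwww !scalerA.
  have -> : c * c * dotr w w = c + c by rewrite /c; field.
  by rewrite scalerDl opprB addrK subrK.
- rewrite mulmxBr mulmx1 -scalemxAr mulmxA mulmx_dotr mul_scalar_mx scalerA.
  by rewrite mulrC uw scale1r wuv opprB addrC subrK.
Qed.

Lemma char_poly_conj (R : comUnitRingType) (n : nat) (A P P' : 'M[R]_n) :
  P *m P' = 1%:M -> char_poly (P *m A *m P') = char_poly A.
Proof.
move=> PP'; rewrite /char_poly /char_poly_mx !map_mxM /=.
set Q := map_mx polyC P; set Q' := map_mx polyC P'.
have QQ' : Q *m Q' = 1%:M by rewrite -map_mxM PP' map_mx1.
have -> : 'X%:M - Q *m map_mx polyC A *m Q' =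
   Q *m ('X%:M - map_mx polyC A) *m Q'.
  by rewrite mulmxBr mulmxBl scalar_mxC -!mulmxA QQ' mulmx1.
by rewrite !det_mulmx mulrAC -det_mulmx QQ' det1 mul1r.
Qed.

(** The real spectral theorem, with the eigenvalues in the order in which they
    are listed by [s]. *)
Lemma spectral_real (R : rcfType) (s : seq R) (n : nat) (A : 'M[R]_n) :
  A^T = A -> char_poly A = \prod_(x <- s) ('X - x%:P) ->
  exists P : 'M[R]_n,
    P *m P^T = 1%:M /\ P *m A *m P^T = diag_mx (\row_i s`_i).
Proof.
elim: s n A => [|x s IHs] n A As cA.
  have n0 : n = 0%N.
    move: cA => /(congr1 (fun p : {poly R} => size p)).
    by rewrite size_char_poly big_nil size_poly1 => -[].
  move: A As cA; rewrite n0 => A _ _.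
  by exists 1%:M; split; apply/matrixP => -[].
have [m nm] : exists m, n = m.+1.
  exists (size s); move: cA => /(congr1 (fun p : {poly R} => size p)).
  by rewrite size_char_poly size_prod_XsubC => -[].
move: A As cA; rewrite {n}nm -[m.+1]/(1 + m)%N => A As cA.
have /eigenvalueP [v vA v0] : eigenvalue A x.
  by rewrite eigenvalue_root_char cA root_prod_XsubC inE eqxx.
pose e := (Num.sqrt (dotr v v))^-1 *: v.
have eA : e *m A = x *: e by rewrite -scalemxAl vA !scalerA mulrC.
pose e0 : 'rV[R]_(1 + m) := delta_mx 0 0.
have ee : dotr e0 e0 = dotr e e.
  rewrite dotr_delta dotrZ exprVn sqr_sqrtr ?dotr_ge0 // mulVf //.
  by rewrite dotr_eq0.
(* Conjugating by the reflection that sends [e0] to the unit eigenvector [e]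
   splits off the eigenvalue [x]. *)
have [H [Hs HH He]] := householder ee.
have eH : e *m H = e0 by rewrite -He -mulmxA HH mulmx1.
have [B BA] : exists B, B = H *m A *m H by exists (H *m A *m H).
have Bs : B^T = B by rewrite BA !trmx_mul Hs As mulmxA.
have B0 : e0 *m B = x *: e0 by rewrite BA !mulmxA He eA -scalemxAl eH.
have B0j j : B 0 j = x * (j == 0)%:R.
  have := congr1 (fun M : 'rV_(1 + m) => M 0 j) B0.
  by rewrite -rowE !mxE eqxx /=.
pose B' := drsubmx B.
have l0 : lshift m 0 = 0 :> 'I_(1 + m) by apply: val_inj.
have BE : B = block_mx x%:M 0 0 B'.
  rewrite -[LHS]submxK; congr block_mx.
  - rewrite [LHS]mx11_scalar !mxE; congr (_%:M).
    by rewrite l0 B0j eqxx mulr1.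
  - apply/matrixP => i j; rewrite ord1 !mxE.
    by rewrite l0 B0j mulr0.
  - apply/matrixP => i j; rewrite ord1 !mxE.
    by rewrite -Bs mxE l0 B0j mulr0.
have B's : B'^T = B'.
  by rewrite /B' trmx_drsub Bs.
have cB : char_poly B = ('X - x%:P) * char_poly B'.
  rewrite /char_poly BE char_block_diag_mx det_ublock.
  congr (_ * _); rewrite [X in \det X]mx11_scalar det_scalar1.
  by rewrite !mxE /= !mulr1n.
have {cA}cB' : char_poly B' = \prod_(y <- s) ('X - y%:P).
  apply: (@mulfI _ ('X - x%:P)); first by rewrite polyXsubC_eq0.
  by rewrite -cB BA char_poly_conj // cA big_cons.
have [P' [PP' PBP']] := IHs _ _ B's cB'.
pose P0 : 'M[R]_(1 + m) := block_mx 1%:M 0 0 P'.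
have P0T : P0^T = block_mx 1%:M 0 0 P'^T by rewrite tr_block_mx trmx1 !trmx0.
exists (P0 *m H); split.
  rewrite trmx_mul Hs mulmxA -(mulmxA P0 H) HH mulmx1 P0T mulmx_block.
  by rewrite !mulmx0 !mul0mx !mulmx1 !addr0 !add0r PP' -scalar_mx_block.
have -> : P0 *m H *m A *m (P0 *m H)^T = P0 *m B *m P0^T.
  by rewrite trmx_mul Hs BA !mulmxA.
rewrite P0T BE !mulmx_block !mulmx0 !mul0mx !mulmx1 !mul1mx !addr0 !add0r.
rewrite mul0mx PBP'; apply/matrixP => i j; rewrite [RHS]mxE [X in X *+ _]mxE.
case: (split_ordP i) => i' ->; case: (split_ordP j) => j' ->; rewrite eq_shift.
- by rewrite block_mxEul mxE !ord1.
- by rewrite block_mxEur mxE.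
- by rewrite block_mxEdl mxE.
- by rewrite block_mxEdr !mxE.
Qed.

(** * Eigenvalues of graphs and projections *)

Lemma orthoproj_gram (R : realType) (r n : nat) (V : 'M[R]_(r, n)) :
  V *m V^T = 1%:M -> orthoproj R r n (V^T *m V).
Proof.
move=> VV; split.
- by rewrite trmx_mul trmxK.
- by rewrite mulmxA -(mulmxA V^T V) VV mulmx1.
- have Vf : row_free V by apply/row_freeP; exists V^T.
  by rewrite mxrankMfree // mxrank_tr; apply/eqP.
Qed.

(** If the eigenvalues [s] of [A] are listed in decreasing order, the trace of
    [A] on some [r]-dimensional subspace orthogonal to [w] is at least [r] times
    the eigenvalue of index [r], counted from 0: the first [r + 1] eigenvectors
    leave [r] dimensions after one linear condition. *)
Lemma ky_fan_orth (R : rcfType) (n r : nat) (s : seq R) (A : 'M[R]_n)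
    (w : 'cV[R]_n) :
  A^T = A -> char_poly A = \prod_(x <- s) ('X - x%:P) -> sorted >=%R s ->
  (r < n)%N ->
  exists V : 'M[R]_(r, n),
    [/\ V *m V^T = 1%:M, V *m w = 0 & r%:R * s`_r <= \tr (V *m A *m V^T)].
Proof.
move=> As cA ss rn; have [P [PP PAP]] := spectral_real As cA.
have ns : size s = n.
  move: cA => /(congr1 (fun p : {poly R} => size p)).
  by rewrite size_char_poly size_prod_XsubC => -[].
pose f := widen_ord rn; pose U := rowsub f P.
have fI : injective f by move=> i j /(congr1 val) /= /val_inj.
have UXU X : U *m X *m U^T = mxsub f f (P *m X *m P^T).
  by rewrite mxsub_mul -mul_rowsub_mx trmx_mxsub.
have UU : U *m U^T = 1%:M.
  rewrite -[U in U *m _]mulmx1 UXU mulmx1 PP.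
  by apply/matrixP => i j; rewrite !mxE (inj_eq fI).
(* [u] is [w] in eigencoordinates; the rows of [H] other than the first are an
   orthonormal basis of its orthogonal complement. *)
pose u := (U *m w)^T.
pose e0 : 'rV[R]_r.+1 := Num.sqrt (dotr u u) *: delta_mx 0 0.
have ue : dotr u u = dotr e0 e0.
  by rewrite dotrZ dotr_delta mulr1 sqr_sqrtr ?dotr_ge0.
have [H [Hs HH He]] := householder ue.
pose W := rowsub (lift ord0) H.
have WW : W *m W^T = 1%:M.
  have -> : W *m W^T = mxsub (lift ord0) (lift ord0) (H *m H^T).
    by rewrite mxsub_mul trmx_mxsub.
  by rewrite Hs HH; apply/matrixP => i j; rewrite !mxE (inj_eq lift_inj).
have trW (X : 'M_r.+1) :
    \tr (W *m X *m W^T) = \sum_i \sum_j (W *m X) i j * W i j.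
  apply: eq_bigr => i _; rewrite mxE.
  by apply: eq_bigr => j _; rewrite [W^T _ _]mxE.
exists (W *m U); split.
- by rewrite trmx_mul mulmxA -(mulmxA W) UU mulmx1.
- rewrite -mulmxA -[U *m w]trmxK -/u -[W]trmxK -trmx_mul.
  apply/colP => i; rewrite mxE [RHS]mxE.
  have -> : (u *m W^T) 0 i = (u *m H) 0 (lift ord0 i).
    by rewrite !mxE; apply: eq_bigr => l _; rewrite -[in RHS]Hs !mxE.
  by rewrite He !mxE mulr0.
have -> : W *m U *m A *m (W *m U)^T = W *m (U *m A *m U^T) *m W^T.
  by rewrite trmx_mul !mulmxA.
rewrite UXU PAP trW.
have -> : r%:R = \sum_i \sum_j W i j * W i j :> R.
  by rewrite -[LHS](mxtrace1 _ r) -WW -[X in \tr (X *m _)]mulmx1 trW mulmx1.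
rewrite mulr_suml; apply: ler_sum => i _.
rewrite mulr_suml; apply: ler_sum => j _.
rewrite [X in _ <= X * _]mxE (bigD1 j) //= big1 ?addr0 => [|l lj]; last first.
  by rewrite !mxE (inj_eq fI) (negPf lj) mulr0.
rewrite !mxE eqxx mulr1n [leRHS]mulrAC.
apply: ler_wpM2l; first by rewrite -expr2 sqr_ge0.
apply: (sorted_leq_nth (rev_trans le_trans) (@lexx _ _)); rewrite ?inE ?ns //.
by rewrite /= -ltnS.
Qed.

Lemma lambda_le_norm1 (R : realType) (r : nat) (G : sgraph) :
  (r < #|G|)%N ->
  exists2 Q, orthoproj R r #|G| Q &
    r%:R * (lambda R r.+1 G + 1) <= 2^-1 * norm1 Q.
Proof.
move=> rn.
have [V [VV V1 trV]] := ky_fan_orth (const_mx 1) (adjmx_sym R G)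
  (eigenvaluesP (adjmx_sym R G)) (eigenvalues_sorted _) rn.
pose Q := V^T *m V.
have QP : orthoproj R r #|G| Q by exact: orthoproj_gram.
exists Q => //.
have sQ : \sum_i \sum_j Q i j = 0.
  transitivity
    (((const_mx 1 : 'rV[R]_#|G|) *m (Q *m const_mx 1)) 0 (0 : 'I_1)).
    rewrite mxE; apply: eq_bigr => i _; rewrite !mxE mul1r.
    by apply: eq_bigr => j _; rewrite [const_mx _ _ _]mxE mulr1.
  by rewrite /Q -(mulmxA V^T) V1 mulmx0 mulmx0 mxE.
rewrite mulrDr mulr1 -[X in _ + X](mxtrace_orthoproj QP) -/Q.
apply: (@le_trans _ _ (\tr (adjmx R G *m Q) + \tr Q)).
  by rewrite lerD2r [leRHS]mxtrace_mulC /Q -mulmxA [leRHS]mxtrace_mulC.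
(* Entrywise, [A_ij Q_ij <= (|Q_ij| + Q_ij) / 2], and the [Q_ij] sum to 0. *)
rewrite -[norm1 Q]addr0 -sQ /norm1 /mxtrace.
rewrite -!big_split /= mulr_sumr; apply: ler_sum => i _.
rewrite mxE -big_split (bigD1 i) //= [in leRHS](bigD1 i) //= addrAC mulrDr.
apply: lerD.
  rewrite mxE edge_irrefl mul0r add0r.
  have := ler_norm (Q i i); lra.
rewrite mulr_sumr; apply: ler_sum => j _.
have -> : Q j i = Q i j by rewrite -[Q in LHS](trmxK Q) mxE; case: QP => ->.
rewrite mxE; have := ler_norm (Q i j); have := ler_norm (- Q i j); rewrite normrN.
by case: edge => /=; lra.
Qed.

(** * Fourth moments of vectors in the range of a projection *)

(** The sum of a four-index tensor over all its indices. *)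
Definition sum4 (R : pzRingType) (n : nat)
    (F : 'I_n -> 'I_n -> 'I_n -> 'I_n -> R) : R :=
  \sum_a \sum_b \sum_c \sum_d F a b c d.

Lemma eq_sum4 (R : pzRingType) (n : nat)
    (F G : 'I_n -> 'I_n -> 'I_n -> 'I_n -> R) :
  (forall a b c d, F a b c d = G a b c d) -> sum4 F = sum4 G.
Proof. by move=> FG; do 4!(apply: eq_bigr => ? _). Qed.

Lemma sum4D (R : pzRingType) (n : nat)
    (F G : 'I_n -> 'I_n -> 'I_n -> 'I_n -> R) :
  sum4 (fun a b c d => F a b c d + G a b c d) = sum4 F + sum4 G.
Proof.
rewrite /sum4 -big_split.
by do 3!(apply: eq_bigr => ? _; rewrite -big_split).
Qed.

Lemma sum4Z (R : pzRingType) (n : nat) (k : R)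
    (F : 'I_n -> 'I_n -> 'I_n -> 'I_n -> R) :
  sum4 (fun a b c d => k * F a b c d) = k * sum4 F.
Proof.
rewrite /sum4 mulr_sumr.
by do 3!(apply: eq_bigr => ? _; rewrite mulr_sumr).
Qed.

Lemma sum4_sum (R : pzRingType) (n : nat) (I : finType)
    (F : I -> 'I_n -> 'I_n -> 'I_n -> 'I_n -> R) :
  sum4 (fun a b c d => \sum_i F i a b c d) = \sum_i sum4 (F i).
Proof.
by rewrite /sum4 [RHS]exchange_big;
   do 3!(apply: eq_bigr => ? _; rewrite [RHS]exchange_big); apply: eq_bigr.
Qed.

Lemma sum4_mul (R : comPzRingType) (n : nat) (F G : 'I_n -> 'I_n -> R) :
  sum4 (fun a b c d => F a b * G c d) =
  (\sum_a \sum_b F a b) * (\sum_c \sum_d G c d).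
Proof.
rewrite /sum4 mulr_suml; apply: eq_bigr => a _.
rewrite mulr_suml; apply: eq_bigr => b _.
by rewrite mulr_sumr; apply: eq_bigr => c _; rewrite mulr_sumr.
Qed.

Lemma sum4_swap23 (R : pzRingType) (n : nat)
    (F : 'I_n -> 'I_n -> 'I_n -> 'I_n -> R) :
  sum4 F = sum4 (fun a b c d => F a c b d).
Proof. by apply: eq_bigr => a _; rewrite exchange_big. Qed.

Lemma sum4_swap34 (R : pzRingType) (n : nat)
    (F : 'I_n -> 'I_n -> 'I_n -> 'I_n -> R) :
  sum4 F = sum4 (fun a b c d => F a b d c).
Proof. by do 2!(apply: eq_bigr => ? _); rewrite exchange_big. Qed.

(** The sum of the three pairings of four indices under the form [Q]: up to a
    factor, the fourth moment of the uniform measure on the unit sphere of the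
    range of a projection [Q]. *)
Definition pair4 (R : pzRingType) (n : nat) (Q : 'M[R]_n) (a b c d : 'I_n) : R :=
  Q a b * Q c d + Q a c * Q b d + Q a d * Q b c.

(** Against a tensor invariant under permutations of the indices, the three
    pairings contribute equally. *)
Lemma sum4_pair4 (R : comPzRingType) (n : nat) (Q : 'M[R]_n)
    (X : 'I_n -> 'I_n -> 'I_n -> 'I_n -> R) :
  Q^T = Q -> (forall a b c d, X a b c d = X a c b d) ->
  (forall a b c d, X a b c d = X a b d c) ->
  sum4 (fun a b c d => X a b c d * pair4 Q a b c d) =
  3 * sum4 (fun a b c d => X a b c d * (Q a b * Q c d)).
Proof.
move=> Qs X23 X34.
have QC a b : Q a b = Q b a by rewrite -[in LHS]Qs mxE.
rewrite (eq_sum4 (G := fun a b c d => X a b c d * (Q a b * Q c d) +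
  X a b c d * (Q a c * Q b d) + X a b c d * (Q a d * Q b c))); last first.
  by move=> a b c d; rewrite !mulrDr.
rewrite !sum4D.
have e2 : sum4 (fun a b c d => X a b c d * (Q a c * Q b d)) =
  sum4 (fun a b c d => X a b c d * (Q a b * Q c d)).
  by rewrite sum4_swap23; apply: eq_sum4 => a b c d; rewrite X23.
have -> : sum4 (fun a b c d => X a b c d * (Q a d * Q b c)) =
  sum4 (fun a b c d => X a b c d * (Q a c * Q b d)).
  by rewrite sum4_swap34; apply: eq_sum4 => a b c d; rewrite X34.
by rewrite !e2; ring.
Qed.

Lemma sum_sqr_proj (R : comPzRingType) (n : nat) (Q : 'M[R]_n) :
  Q^T = Q -> Q *m Q = Q -> \sum_a \sum_b Q a b * Q a b = \tr Q.
Proof.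
move=> Qs QQ; rewrite -[in RHS]QQ; apply: eq_bigr => a _; rewrite mxE.
by apply: eq_bigr => b _; rewrite -[in X in _ * X = _]Qs mxE.
Qed.

Lemma sum4_pair4_pair (R : comPzRingType) (n : nat) (Q : 'M[R]_n) :
  Q^T = Q -> Q *m Q = Q ->
  sum4 (fun a b c d => pair4 Q a b c d * pair4 Q a b c d) =
  3 * (\tr Q ^+ 2 + 2 * \tr Q).
Proof.
move=> Qs QQ.
have QC a b : Q a b = Q b a by rewrite -[in LHS]Qs mxE.
have QQE a b : \sum_c Q a c * Q c b = Q a b by rewrite -[in RHS]QQ mxE.
have tQ := sum_sqr_proj Qs QQ.
rewrite sum4_pair4 // => [|a b c d|a b c d]; last 2 first.
- by rewrite /pair4 (QC c b); ring.
- by rewrite /pair4 (QC d c); ring.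
congr (_ * _).
rewrite (eq_sum4 (G := fun a b c d => (Q a b * Q a b) * (Q c d * Q c d) +
  Q a b * Q b d * (Q a c * Q c d) + Q a b * Q b c * (Q a d * Q d c))); last first.
  by move=> a b c d; rewrite /pair4 (QC d c); ring.
rewrite !sum4D sum4_mul tQ -addrA -expr2; congr (_ + _).
have e2 : sum4 (fun a b c d => Q a b * Q b d * (Q a c * Q c d)) = \tr Q.
  rewrite sum4_swap34 sum4_swap23 -tQ.
  apply: eq_bigr => a _; apply: eq_bigr => d _.
  rewrite -[X in _ = X * _]QQE mulr_suml; apply: eq_bigr => b _.
  by rewrite -[X in _ = _ * X]QQE mulr_sumr.
by rewrite (sum4_swap34 (fun a b c d => Q a b * Q b c * _)) e2; ring.
Qed.

(** A weighted system of vectors in the range of a projection of rank at most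
    [r], normalized by [\sum_i w_i |l_i|^4 = 1], has a fourth moment
    [\sum_ij w_i w_j <l_i, l_j>^4] at least that of the uniform measure on the
    unit sphere of an [r]-dimensional space.  The vectors [l_i] are the rows of
    [L].  The proof compares the tensor [\sum_i w_i l_i^{(x) 4}] with a multiple
    of [pair4 Q]. *)
Lemma fourth_moment_ge (R : realFieldType) (n : nat) (r : R) (w : 'I_n -> R)
    (L Q : 'M[R]_n) :
  Q^T = Q -> Q *m Q = Q -> 0 < r -> \tr Q <= r -> L *m Q = L ->
  \sum_i w i * (L *m L^T) i i ^+ 2 = 1 ->
  3 / (r * (r + 2)) <= \sum_i \sum_j w i * w j * (L *m L^T) i j ^+ 4.
Proof.
move=> Qs QQ r0 Qr LQ w1.
have KE i j : (L *m L^T) i j = \sum_a L i a * L j a.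
  by rewrite mxE; apply: eq_bigr => a _; rewrite mxE.
pose x i a b c d := L i a * L i b * L i c * L i d.
pose T a b c d := \sum_i w i * x i a b c d.
have TX X : sum4 (fun a b c d => T a b c d * X a b c d) =
    \sum_i w i * sum4 (fun a b c d => x i a b c d * X a b c d).
  rewrite (eq_sum4 (G := fun a b c d => \sum_i w i * (x i a b c d * X a b c d))).
    by rewrite sum4_sum; apply: eq_bigr => i _; rewrite sum4Z.
  by move=> a b c d; rewrite mulr_suml; apply: eq_bigr => i _; rewrite mulrA.
have TT : sum4 (fun a b c d => T a b c d * T a b c d) =
    \sum_i \sum_j w i * w j * (L *m L^T) i j ^+ 4.
  rewrite TX; apply: eq_bigr => i _.
  rewrite (eq_sum4 (G := fun a b c d => T a b c d * x i a b c d)); last first.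
    by move=> a b c d; rewrite mulrC.
  rewrite TX mulr_sumr; apply: eq_bigr => j _; rewrite mulrA; congr (_ * _).
  rewrite (eq_sum4 (G := fun a b c d => ((L i a * L j a) * (L i b * L j b)) *
    ((L i c * L j c) * (L i d * L j d)))); last by move=> *; rewrite /x; ring.
  rewrite sum4_mul -[4%N]/(2 + 2)%N exprD.
  suff -> : \sum_a \sum_b L i a * L j a * (L i b * L j b) =
    (L *m L^T) i j ^+ 2 by [].
  by rewrite KE expr2 mulr_suml; apply: eq_bigr => a _; rewrite mulr_sumr.
have TE : sum4 (fun a b c d => T a b c d * pair4 Q a b c d) = 3.
  rewrite sum4_pair4 // => [|a b c d|a b c d]; last 2 first.
  - by apply: eq_bigr => i _; rewrite /x; ring.
  - by apply: eq_bigr => i _; rewrite /x; ring.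
  rewrite TX -[RHS]mulr1 -w1; congr (_ * _); apply: eq_bigr => i _; congr (_ * _).
  rewrite (eq_sum4 (G := fun a b c d => (L i a * Q a b * L i b) *
    (L i c * Q c d * L i d))); last by move=> *; rewrite /x; ring.
  rewrite sum4_mul -expr2; congr (_ ^+ 2).
  rewrite KE exchange_big; apply: eq_bigr => b _ /=.
  by rewrite -mulr_suml -[in X in _ = X * _]LQ mxE.
have EE := sum4_pair4_pair Qs QQ.
set q := \tr Q in Qr EE.
have q0 : 0 <= q.
  rewrite /q -(sum_sqr_proj Qs QQ); apply: sumr_ge0 => a _.
  by apply: sumr_ge0 => b _; rewrite -expr2 sqr_ge0.
(* The multiple of [pair4 Q] that equals the tensor of the uniform measure. *)
pose k := (r * (r + 2))^-1.
have : 0 <= sum4 (fun a b c d => (T a b c d - k * pair4 Q a b c d) ^+ 2).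
  by do 4!(apply: sumr_ge0 => ? _); rewrite sqr_ge0.
rewrite (eq_sum4 (G := fun a b c d => T a b c d * T a b c d +
  (- (2 * k)) * (T a b c d * pair4 Q a b c d) +
  k ^+ 2 * (pair4 Q a b c d * pair4 Q a b c d))); last by move=> *; ring.
rewrite !sum4D !sum4Z TT TE EE; set B := \sum_i _.
have k0 : 0 < k by rewrite invr_gt0; nra.
have kr : k * (r * (r + 2)) = 1 by rewrite mulVf // gt_eqF //; nra.
have : k ^+ 2 * (q ^+ 2 + 2 * q) <= k.
  rewrite expr2 -mulrA ger_pMr // -kr ler_pM2l //; nra.
rewrite -/k; lra.
Qed.

(** * Existence of an extremal pair *)

(** [Q] is an orthogonal projection of rank at most [r]; the rank of a
    projection is its trace. *)
Definition proj_le (R : realDomainType) (n r : nat) (Q : 'M[R]_n) : Prop :=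
  [/\ Q^T = Q, Q *m Q = Q & \tr Q <= r%:R].

Lemma continuous_sum (R : realType) (T : topologicalType) (I : Type)
    (s : seq I) (F : I -> T -> R) :
  (forall i, continuous (F i)) -> continuous (fun x => \sum_(i <- s) F i x).
Proof.
by move=> cF; apply: continuous_big => [|i _]; [exact: add_continuous|exact: cF].
Qed.

Lemma compact_box (R : realType) (n : nat) (M : R) (A : set 'rV[R]_n) :
  closed A -> (forall v, A v -> forall i, `|v 0 i| <= M) -> compact A.
Proof.
move=> cA AM.
have cB := @rV_compact R n (fun=> `[- M, M]%classic)
  (fun _ => @segment_compact _ _ _).
apply: subclosed_compact cA cB _ => v /AM vM i /=.
by rewrite in_itv /= -ler_norml.
Qed.

Lemma proj_entry_le (R : realType) (n : nat) (Q : 'M[R]_n) (i j : 'I_n) :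
  Q^T = Q -> Q *m Q = Q -> `|Q i j| <= 1.
Proof.
move=> Qs QQ.
have QE a : \sum_b Q a b ^+ 2 = Q a a.
  rewrite -[in RHS]QQ mxE; apply: eq_bigr => b _.
  by rewrite expr2 -[in X in _ = _ * X]Qs mxE.
have le1 a b : Q a b ^+ 2 <= Q a a.
  by rewrite -QE (bigD1 b) //= lerDl sumr_ge0 // => c _; rewrite sqr_ge0.
have Qii : Q i i <= 1 by have := le1 i i; nra.
have : `|Q i j| ^+ 2 <= 1 by rewrite real_normK ?num_real // (le_trans (le1 i j)).
by rewrite -[leRHS](expr1n _ 2) ler_sqr ?nnegrE.
Qed.

(** The maximum of [\sum_i \sum_j |t_i t_j Q_ij|] over unit vectors [t] and
    projections of rank at most [r] is attained, by compactness, and at some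
    [t >= 0]. *)
Lemma extremal_pair (R : realType) (n r : nat) : (0 < n)%N ->
  exists (t : 'I_n -> R) (Q : 'M[R]_n),
    [/\ forall i, 0 <= t i, \sum_i t i ^+ 2 = 1, proj_le r Q &
     forall (t' : 'I_n -> R) (Q' : 'M[R]_n),
       \sum_i t' i ^+ 2 = 1 -> proj_le r Q' ->
       \sum_i \sum_j `|t' i * t' j * Q' i j| <=
       \sum_i \sum_j t i * t j * `|Q i j|].
Proof.
move=> n0.
(* A pair [(t, Q)] is encoded as one row vector, [t] followed by the entries of
   [Q]. *)
pose t_ i (v : 'rV[R]_(n + n * n)) : R := v 0 (lshift (n * n) i).
pose q_ i j (v : 'rV[R]_(n + n * n)) : R := v 0 (rshift n (mxvec_index i j)).
have ct i : continuous (t_ i) by exact: coord_continuous.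
have cq i j : continuous (q_ i j) by exact: coord_continuous.
pose Qof v : 'M[R]_n := \matrix_(i, j) q_ i j v.
pose A1 := [set v | \sum_i t_ i v ^+ 2 = 1].
pose A2 := [set v | \sum_i q_ i i v <= r%:R].
pose A3 := \bigcap_(p in [set: 'I_n * 'I_n])
  [set v | q_ p.1 p.2 v - q_ p.2 p.1 v = 0].
pose A4 := \bigcap_(p in [set: 'I_n * 'I_n])
  [set v | \sum_k q_ p.1 k v * q_ k p.2 v - q_ p.1 p.2 v = 0].
pose A := A1 `&` A2 `&` A3 `&` A4.
have AP v : A v <-> \sum_i t_ i v ^+ 2 = 1 /\ proj_le r (Qof v).
  split=> [[[[v1 v2] v3] v4]|[v1 [Qs QQ Qr]]].
    split=> //; split.
    - apply/matrixP => i j; rewrite !mxE; apply/eqP; rewrite -subr_eq0.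
      by apply/eqP; have := v3 (j, i) I.
    - apply/matrixP => i j; rewrite !mxE; apply/eqP; rewrite -subr_eq0.
      apply/eqP; rewrite -[RHS](v4 (i, j) I); congr (_ - _) => /=.
      by apply: eq_bigr => k _; rewrite !mxE.
    - by rewrite /mxtrace; under eq_bigr do rewrite mxE.
  split; [split; [split|]|] => //=.
  - by move: Qr; rewrite /mxtrace; under eq_bigr do rewrite mxE.
  - move=> [i j] _ /=; move/matrixP/(_ j i): Qs; rewrite !mxE => ->.
    by rewrite subrr.
  - move=> [i j] _ /=; move/matrixP/(_ i j): QQ; rewrite !mxE => <-.
    apply/eqP; rewrite subr_eq0; apply/eqP.
    by apply: eq_bigr => k _; rewrite !mxE.
have cA : closed A.
  apply: closedI; first apply: closedI; first apply: closedI.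
  - apply: (preimage_closed _ (@closed_eq _ 1)) => v _.
    apply: (@continuous_sum _ _ _ _ (fun i v => t_ i v ^+ 2)) => i {}v.
    exact: (cvgM (ct i v) (ct i v)).
  - apply: (preimage_closed _ (@closed_le _ _)) => v _.
    by apply: (@continuous_sum _ _ _ _ (fun i v => q_ i i v)) => i; exact: cq.
  - apply: closed_bigI => -[i j] _ /=.
    apply: (preimage_closed _ (@closed_eq _ 0)) => v _.
    exact: (cvgB (cq i j v) (cq j i v)).
  - apply: closed_bigI => -[i j] _ /=.
    apply: (preimage_closed _ (@closed_eq _ 0)) => v _.
    apply: (cvgB _ (cq i j v)).
    apply: (@continuous_sum _ _ _ _ (fun k v => q_ i k v * q_ k j v)) => k {}v.
    exact: (cvgM (cq i k v) (cq k j v)).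
have kA : compact A.
  apply: (@compact_box _ _ 1) cA _ => v /AP [v1 [Qs QQ _]] i.
  case: (split_ordP i) => k ->.
    have : `|v 0 (lshift (n * n) k)| ^+ 2 <= 1.
      rewrite real_normK ?num_real // -v1 (bigD1 k) //= lerDl.
      by rewrite sumr_ge0 // => c _; rewrite sqr_ge0.
    by rewrite -[leRHS](expr1n _ 2) ler_sqr ?nnegrE.
  case/mxvec_indexP: k => a b.
  by have := proj_entry_le a b Qs QQ; rewrite mxE.
pose enc (t : 'I_n -> R) (Q : 'M[R]_n) := row_mx (\row_i t i) (mxvec Q).
have tenc t Q i : t_ i (enc t Q) = t i by rewrite /t_ row_mxEl mxE.
have qenc t Q i j : q_ i j (enc t Q) = Q i j by rewrite /q_ row_mxEr mxvecE.
have Aenc t Q : \sum_i t i ^+ 2 = 1 -> proj_le r Q -> A (enc t Q).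
  move=> t1 Qr; apply/AP; split.
    by rewrite -t1; apply: eq_bigr => i _; rewrite tenc.
  by have -> : Qof (enc t Q) = Q by apply/matrixP => i j; rewrite mxE qenc.
pose f v := \sum_i \sum_j `|t_ i v * t_ j v * q_ i j v|.
have cf : continuous f.
  apply: (@continuous_sum _ _ _ _
    (fun i v => \sum_j `|t_ i v * t_ j v * q_ i j v|)) => i.
  apply: (@continuous_sum _ _ _ _
    (fun j v => `|t_ i v * t_ j v * q_ i j v|)) => j v.
  exact: (cvg_norm (cvgM (cvgM (ct i v) (ct j v)) (cq i j v))).
have [|v /set_mem /AP [v1 vr] vmax] :=
  @compact_EVT_max _ R f A _ kA (continuous_subspaceT cf).
  exists (enc (fun i => (i == Ordinal n0)%:R) 0); apply: Aenc.
    rewrite (bigD1 (Ordinal n0)) //= ?eqxx big1 ?expr1n ?addr0 // => i /negPf ->.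
    by rewrite expr0n.
  by split; rewrite ?trmx0 ?mulmx0 // mxtrace0.
exists (fun i => `|t_ i v|), (Qof v); split=> [i|||t' Q' t1 Qr] //.
  by rewrite -v1; apply: eq_bigr => i _; rewrite real_normK ?num_real.
have := vmax (enc t' Q') (mem_set (Aenc _ _ t1 Qr)).
rewrite /f; under eq_bigr do under eq_bigr do rewrite !tenc qenc.
move=> /le_trans -> //; apply: ler_sum => i _; apply: ler_sum => j _.
by rewrite !normrM mxE.
Qed.

(** * First-order conditions and square roots *)

Lemma mulmx_tr_eq0 (R : realDomainType) (m n : nat) (X : 'M[R]_(m, n)) :
  X *m X^T = 0 -> X = 0.
Proof.
move=> XX; apply/row_matrixP => i; rewrite row0; apply/eqP.
by rewrite -dotr_eq0 dotr_row XX mxE.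
Qed.

(** A linear function of [e] bounded by a quadratic one vanishes. *)
Lemma first_order (R : realFieldType) (a b : R) :
  (forall e, e * a <= e ^+ 2 * b) -> a = 0.
Proof.
move=> h; apply/eqP; apply: contraT => a0.
have a2 : 0 < a ^+ 2 by rewrite exprn_even_gt0.
have c0 : 0 < `|b| + 1 by rewrite ltr_wpDl.
have := h (a / (`|b| + 1)).
rewrite -(ler_pM2r (exprn_gt0 2 c0)).
have -> : a / (`|b| + 1) * a * (`|b| + 1) ^+ 2 = a ^+ 2 * (`|b| + 1).
  by field; rewrite gt_eqF.
have -> : (a / (`|b| + 1)) ^+ 2 * b * (`|b| + 1) ^+ 2 = a ^+ 2 * b.
  by field; rewrite gt_eqF.
by rewrite ler_pM2l // => hb; have := ler_norm b; lra.
Qed.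

(** A maximizer of the Rayleigh quotient is an eigenvector. *)
Lemma rayleigh_max (R : realFieldType) (n : nat) (B : 'M[R]_n)
    (t : 'rV[R]_n) (g : R) :
  B^T = B -> dotr t t = 1 -> dotr (t *m B) t = g ->
  (forall x, dotr (x *m B) x <= g * dotr x x) -> t *m B = g *: t.
Proof.
move=> Bs t1 tg h; apply/rowP => i.
rewrite -[LHS]dotr_deltar -[RHS]dotr_deltar dotrZl.
set y := delta_mx 0 i; apply/eqP; rewrite -subr_eq0; apply/eqP.
apply: (@first_order _ _ ((g * dotr y y - dotr (y *m B) y) / 2)) => e.
have := h (t + e *: y).
rewrite mulmxDl -scalemxAl !dotrDl !dotrDr !dotrZl !dotrZr t1 tg (dotrC y t).
rewrite (dotr_mulmx B y t) Bs (dotrC y); lra.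
Qed.

Lemma mxtrace_rank1 (R : comPzRingType) (n : nat) (M : 'M[R]_n) (u : 'rV[R]_n) :
  \tr (M *m (u^T *m u)) = dotr (u *m M) u.
Proof. by rewrite mulmxA mxtrace_mulC mulmxA trace_mx11. Qed.

Lemma proj_add (R : realFieldType) (n : nat) (Q : 'M[R]_n) (u : 'rV[R]_n) :
  Q^T = Q -> Q *m Q = Q -> u *m Q = 0 -> u != 0 ->
  let Q' := Q + (dotr u u)^-1 *: (u^T *m u) in
  [/\ Q'^T = Q', Q' *m Q' = Q' & \tr Q' = \tr Q + 1].
Proof.
move=> Qs QQ uQ u0 /=.
have uu : dotr u u != 0 by rewrite dotr_eq0.
have Qu : Q *m u^T = 0 by rewrite -[Q *m _]trmxK trmx_mul trmxK Qs uQ trmx0.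
split.
- by rewrite linearD linearZ /= trmx_mul trmxK Qs.
- rewrite mulmxDl !mulmxDr QQ -!scalemxAl -!scalemxAr mulmxA Qu mul0mx.
  rewrite -(mulmxA u^T) uQ mulmx0 !scaler0 addr0 add0r.
  rewrite mulmxA -(mulmxA u^T u) mulmx_dotr mul_mx_scalar -scalemxAl.
  by rewrite !scalerA mulVf // mulr1.
- rewrite mxtraceD mxtraceZ -[u^T *m u]mul1mx mxtrace_rank1 mulmx1.
  by rewrite mulVf.
Qed.

Lemma proj_sub (R : realFieldType) (n : nat) (Q : 'M[R]_n) (u : 'rV[R]_n) :
  Q^T = Q -> Q *m Q = Q -> u *m Q = u -> u != 0 ->
  let Q' := Q - (dotr u u)^-1 *: (u^T *m u) in
  [/\ Q'^T = Q', Q' *m Q' = Q', \tr Q' = \tr Q - 1 & u *m Q' = 0].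
Proof.
move=> Qs QQ uQ u0 /=.
have uu : dotr u u != 0 by rewrite dotr_eq0.
have Qu : Q *m u^T = u^T by rewrite -[Q *m _]trmxK trmx_mul trmxK Qs uQ.
split.
- by rewrite linearB linearZ /= trmx_mul trmxK Qs.
- rewrite mulmxBl !mulmxBr QQ -!scalemxAl -!scalemxAr mulmxA Qu.
  rewrite -(mulmxA u^T) uQ.
  rewrite mulmxA -(mulmxA u^T u) mulmx_dotr mul_mx_scalar -scalemxAl.
  by rewrite !scalerA mulVf // mulr1 subrr subr0.
- rewrite linearB /= mxtraceZ -[u^T *m u]mul1mx mxtrace_rank1 mulmx1.
  by rewrite mulVf.
- rewrite mulmxBr uQ -scalemxAr mulmxA mulmx_dotr mul_scalar_mx scalerA.
  by rewrite mulVf // scale1r subrr.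
Qed.

(** A projection [Q] of rank at most [r] maximizing [\tr (M *m Q)] commutes with
    the symmetric matrix [M], and [M] is positive semidefinite on the range of
    [Q]: otherwise tilting a line of the range out of it, or dropping a line,
    would increase the trace. *)
Lemma ky_fan_max (R : realFieldType) (n r : nat) (M Q : 'M[R]_n) :
  M^T = M -> proj_le r Q ->
  (forall Q', proj_le r Q' -> \tr (M *m Q') <= \tr (M *m Q)) ->
  Q *m M = M *m Q /\ forall x, 0 <= dotr (x *m (M *m Q)) x.
Proof.
move=> Ms [Qs QQ Qr] h.
have psd a : a *m Q = a -> 0 <= dotr (a *m M) a.
  move=> aQ; have [->|a0] := eqVneq a 0.
    by rewrite /dotr trmx0 mulmx0 mxE.
  have [Q's Q'Q' trQ' _] := proj_sub Qs QQ aQ a0.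
  set Q' := Q - _ in Q's Q'Q' trQ'.
  have /h : proj_le r Q' by split=> //; rewrite trQ'; lra.
  rewrite /Q' mulmxBr linearB /= -scalemxAr mxtraceZ mxtrace_rank1.
  by rewrite gerBl pmulr_rge0 // invr_gt0 dotr_gt0.
have tilt a b : a *m Q = a -> b *m Q = 0 -> dotr (a *m M) b = 0.
  move=> aQ bQ; have [->|a0] := eqVneq a 0.
    by rewrite !mul0mx /dotr mul0mx mxE.
  have ab : dotr a b = 0 by rewrite -aQ dotr_mulmx Qs bQ /dotr trmx0 mulmx0 mxE.
  have aa : 0 < dotr a a by rewrite dotr_gt0.
  have bb := dotr_ge0 b.
  have [Q0s Q0Q0 trQ0 aQ0] := proj_sub Qs QQ aQ a0.
  (* The line of [a] is replaced by that of [a + e b]. *)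
  apply: (@first_order _ _
    ((dotr (a *m M) a * dotr b b / dotr a a - dotr (b *m M) b) / 2)) => e.
  set w := a + e *: b.
  have ww : dotr w w = dotr a a + e ^+ 2 * dotr b b.
    by rewrite /w dotrDl !dotrDr !dotrZl !dotrZr (dotrC b a) ab; ring.
  have ww0 : 0 < dotr w w by rewrite ww; have := sqr_ge0 e; nra.
  have w0 : w != 0 by rewrite -dotr_gt0.
  have wQ0 : w *m (Q - (dotr a a)^-1 *: (a^T *m a)) = 0.
    rewrite /w mulmxDl aQ0 add0r -scalemxAl mulmxBr bQ -scalemxAr mulmxA.
    rewrite mulmx_dotr (dotrC b a) ab mul_scalar_mx.
    by rewrite scale0r scaler0 subr0 scaler0.
  have [Q's Q'Q' trQ'] := proj_add Q0s Q0Q0 wQ0 w0.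
  set Q' := (X in X^T = X) in Q's Q'Q' trQ'.
  have /h : proj_le r Q' by split=> //; rewrite trQ' trQ0; lra.
  rewrite /Q' mulmxDr mulmxBr linearD linearB /= -!scalemxAr !mxtraceZ.
  rewrite !mxtrace_rank1.
  have -> : dotr (w *m M) w = dotr (a *m M) a + 2 * e * dotr (a *m M) b +
      e ^+ 2 * dotr (b *m M) b.
    rewrite /w mulmxDl -scalemxAl !dotrDl !dotrDr !dotrZl !dotrZr.
    by rewrite (dotr_mulmx M b a) Ms (dotrC b); ring.
  rewrite -addrA gerDl addrC subr_le0 mulrC ler_pdivrMr // ww => le.
  set x := dotr (a *m M) a in le *; set y := dotr (a *m M) b in le *.
  set z := dotr (b *m M) b in le *.
  have -> : e ^+ 2 * ((x * dotr b b / dotr a a - z) / 2) =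
    ((dotr a a)^-1 * x * (dotr a a + e ^+ 2 * dotr b b) - x - e ^+ 2 * z) / 2.
    by field; rewrite gt_eqF.
  lra.
have QM0 : Q *m M *m (1%:M - Q) = 0.
  apply/row_matrixP => i; rewrite row0; apply/rowP => j.
  rewrite -[LHS]dotr_deltar rowE [RHS]mxE !mulmxA dotr_mulmx linearB /= trmx1 Qs.
  apply: tilt; first by rewrite -mulmxA QQ.
  by rewrite -mulmxA mulmxBl mul1mx QQ subrr mulmx0.
have QMQ : Q *m M *m Q = Q *m M.
  by apply/eqP; rewrite eq_sym -subr_eq0 -QM0 mulmxBr mulmx1.
have QM : Q *m M = M *m Q.
  have := congr1 trmx QMQ; rewrite !trmx_mul Ms Qs => MQ.
  by rewrite -QMQ -mulmxA MQ.
split=> // x.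
have -> : M *m Q = Q *m M *m Q by rewrite QM -mulmxA QQ.
rewrite !mulmxA dotr_mulmx Qs; apply: psd.
by rewrite -mulmxA QQ.
Qed.

Lemma psd_sqrt (R : realType) (n : nat) (K : 'M[R]_n) :
  K^T = K -> (forall x, 0 <= dotr (x *m K) x) ->
  exists2 L : 'M[R]_n, L^T = L & L *m L = K.
Proof.
move=> Ks psd; have [s cK] := char_poly_sym_split Ks.
have [P [PP PKP]] := spectral_real Ks cK.
have P'P : P^T *m P = 1%:M by apply: mulmx1C.
have s0 i : 0 <= (\row_(i < n) s`_i) 0 i.
  have := psd (row i P); congr (_ <= _).
  by rewrite -row_mul dotr_row PKP [LHS]mxE eqxx mulr1n.
pose D : 'M[R]_n := diag_mx (\row_i Num.sqrt s`_i).
have DD : D *m D = diag_mx (\row_i s`_i).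
  rewrite mulmx_diag; congr diag_mx; apply/rowP => i; rewrite !mxE.
  by rewrite -expr2 sqr_sqrtr //; have := s0 i; rewrite mxE.
exists (P^T *m D *m P).
  by rewrite !trmx_mul trmxK tr_diag_mx mulmxA.
rewrite !mulmxA -(mulmxA _ P P^T) PP mulmx1 -(mulmxA _ D D) DD -PKP.
by rewrite !mulmxA P'P mul1mx -mulmxA P'P mulmx1.
Qed.

(** The square root of a positive semidefinite matrix lives on every projection
    that contains its range. *)
Lemma sqrt_mul_proj (R : realDomainType) (n : nat) (L Q : 'M[R]_n) :
  L^T = L -> Q^T = Q -> L *m L *m Q = L *m L -> L *m Q = L.
Proof.
move=> Ls Qs LLQ; apply/eqP; rewrite eq_sym -subr_eq0; apply/eqP.
have -> : L - L *m Q = ((1%:M - Q) *m L)^T.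
  by rewrite trmx_mul Ls linearB /= trmx1 Qs mulmxBr mulmx1.
rewrite (mulmx_tr_eq0 (X := (1%:M - Q) *m L)) ?trmx0 //.
rewrite trmx_mul Ls linearB /= trmx1 Qs mulmxA -(mulmxA _ L L) -mulmxA.
by rewrite mulmxBr mulmx1 LLQ subrr mulmx0.
Qed.

(** * The bound on the projection constant *)

(** The identity function of [c] in [[0, 1]] is at most the even quartic
    polynomial that is tangent to it at [1 / s] and meets it at [1].  For
    [s = sqrt (r + 2)], [1 / s] is the cosine of the angle of [r (r + 1) / 2]
    equiangular lines, for which the final bound would be attained.  The
    inequality is multiplied by [2 (1 + s)^2 y^2] and stated for [x = c y]; both
    sides vanish when [y] does. *)
Lemma quartic_majorant (R : realFieldType) (s x y v : R) :
  0 < s -> 0 <= x <= y -> v = (y ^+ 2)^-1 ->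
  2 * (1 + s) ^+ 2 * (y * x) <=
  (s + 2) * y ^+ 2 + (s * (1 + s) ^+ 2 + 2 * s) * x ^+ 2 - s ^+ 3 * (v * x ^+ 4).
Proof.
move=> s0 /andP[x0 xy] ->.
have [y0|yN0] := eqVneq y 0.
  have -> : x = 0 by apply/eqP; rewrite eq_le x0 andbT -y0.
  by rewrite y0 !expr0n /= !mulr0 addr0 subrr.
have y0 : 0 < y by rewrite lt_def yN0 (le_trans x0).
pose c := x / y; have xE : x = c * y by rewrite /c mulfVK.
have c0 : 0 <= c by rewrite /c divr_ge0 // ltW.
have c1 : c <= 1 by rewrite /c ler_pdivrMr // mul1r.
rewrite -subr_ge0 xE.
have -> : (s + 2) * y ^+ 2 + (s * (1 + s) ^+ 2 + 2 * s) * (c * y) ^+ 2 -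
   s ^+ 3 * ((y ^+ 2)^-1 * (c * y) ^+ 4) - 2 * (1 + s) ^+ 2 * (y * (c * y)) =
   ((s * c - 1) * y) ^+ 2 * ((1 - c) * (s * c + 2 + s)) by field.
apply: mulr_ge0; first by rewrite sqr_ge0.
apply: mulr_ge0; first by rewrite subr_ge0.
have := mulr_ge0 (ltW s0) c0; lra.
Qed.

(** The bound on the absolute projection constant, for the weighted functional
    at an extremal pair [(t, Q)] of value [g]: [M] stands for the signed matrix
    [t_i t_j sgn Q_ij], and [K] for its compression to the range of [Q]. *)
Lemma gramian_bound (R : realType) (n r : nat) (g : R) (t : 'I_n -> R)
    (M K Q : 'M[R]_n) :
  (0 < r)%N -> 0 < g -> (forall i, 0 <= t i) -> \sum_i t i ^+ 2 = 1 ->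
  proj_le r Q -> K^T = K -> K *m Q = K -> M *m K = K *m K ->
  (forall x, 0 <= dotr (x *m K) x) ->
  (forall i, K i i = g * t i ^+ 2) ->
  (forall i j, `|M i j| <= t i * t j) ->
  g <= ((r%:R - 1) * Num.sqrt (r%:R + 2) + 2) / (r%:R + 1).
Proof.
move=> r0 g0 t0 t1 [Qs QQ Qr] Ks KQ MK psd Kii Mij.
have [L Ls LL] := psd_sqrt Ks psd.
have LQ : L *m Q = L by apply: sqrt_mul_proj; rewrite ?LL.
have KE i j : K i j = dotr (row i L) (row j L) by rewrite dotr_row Ls LL.
have KC i j : K i j = K j i by rewrite -[in LHS]Ks mxE.
have yy i j : 0 <= g * (t i * t j).
  by apply: mulr_ge0; [exact: ltW | exact: mulr_ge0].
have g2 : g ^+ 2 = \sum_i \sum_j (g * (t i * t j)) ^+ 2.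
  rewrite -[LHS]mulr1 -[X in _ * X]mulr1 -{1}t1 -t1 mulr_suml mulr_sumr.
  apply: eq_bigr => i _; rewrite !mulr_sumr; apply: eq_bigr => j _; ring.
have Kij i j : `|K i j| <= g * (t i * t j).
  rewrite -ler_sqr ?nnegrE // real_normK ?num_real //.
  have := dotr_cauchy_schwarz (row i L) (row j L).
  by rewrite -!KE !Kii; congr (_ <= _); ring.
have trK : \tr K = g.
  by rewrite -[RHS]mulr1 -t1 mulr_sumr; apply: eq_bigr.
pose T := \sum_i \sum_j K i j ^+ 2.
have trKK : \tr (K *m K) = T.
  apply: eq_bigr => i _; rewrite mxE; apply: eq_bigr => j _.
  by rewrite expr2 (KC j i).
(* Cauchy-Schwarz for [\tr (K *m Q) = g], with [\tr Q <= r]. *)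
have gT : g ^+ 2 <= r%:R * T.
  have h : 0 <= \sum_i \sum_j (r%:R * K i j - g * Q i j) ^+ 2.
    by apply: sumr_ge0 => i _; apply: sumr_ge0 => j _; rewrite sqr_ge0.
  have trKQ : \sum_i \sum_j K i j * Q i j = g.
    rewrite -trK -[in RHS]KQ; apply: eq_bigr => i _; rewrite mxE.
    by apply: eq_bigr => j _; rewrite -[in RHS]Qs mxE.
  have hE : \sum_i \sum_j (r%:R * K i j - g * Q i j) ^+ 2 =
      r%:R ^+ 2 * T - 2 * r%:R * g * g + g ^+ 2 * \tr Q.
    rewrite -(sum_sqr_proj Qs QQ) -[X in _ * g * X]trKQ /T !mulr_sumr -sumrB.
    rewrite -big_split; apply: eq_bigr => i _ /=.
    rewrite !mulr_sumr -sumrB -big_split; apply: eq_bigr => j _ /=; ring.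
  have rp : 0 < r%:R :> R by rewrite ltr0n.
  rewrite -(ler_pM2l rp).
  have := sqr_ge0 g; nra.
have Tg : T <= g ^+ 2.
  rewrite g2; apply: ler_sum => i _; apply: ler_sum => j _.
  rewrite -(real_normK (num_real (K i j))) ler_sqr ?nnegrE //.
have TM : T <= \sum_i \sum_j t i * t j * `|K i j|.
  rewrite -trKK -MK; apply: ler_sum => i _; rewrite mxE.
  apply: ler_sum => j _; rewrite (KC j i) (le_trans (ler_norm _)) // normrM.
  by rewrite ler_wpM2r.
set s := Num.sqrt _.
have s2 : s ^+ 2 = r%:R + 2 by rewrite sqr_sqrtr // addr_ge0.
have s0 : 0 < s by rewrite sqrtr_gt0 ltr_wpDl.
have rE : r%:R = s ^+ 2 - 2 by rewrite s2 addrK.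
have r1 : 1 <= r%:R :> R by rewrite ler1n.
(* With these weights the rows of [L] are normalized; where [t_i = 0] the row is
   zero, and so is the weight. *)
pose w i := (g ^+ 2 * t i ^+ 2)^-1.
have w1 : \sum_i w i * (L *m L^T) i i ^+ 2 = 1.
  rewrite -t1; apply: eq_bigr => i _; rewrite Ls LL Kii /w.
  have [->|ti] := eqVneq (t i) 0; first by rewrite expr0n !mulr0 expr0n mulr0.
  by field; rewrite ti gt_eqF.
have := fourth_moment_ge Qs QQ (lt_le_trans ltr01 r1) Qr LQ w1.
rewrite Ls LL; set B := \sum_i _ => Bge.
have : 2 * (1 + s) ^+ 2 * (g * T) <=
  (s + 2) * g ^+ 2 + (s * (1 + s) ^+ 2 + 2 * s) * T - s ^+ 3 * (g ^+ 2 * B).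
  apply: (@le_trans _ _
    (\sum_i \sum_j 2 * (1 + s) ^+ 2 * (g * (t i * t j) * `|K i j|))).
    have k0 : 0 <= 2 * (1 + s) ^+ 2 * g.
      apply: mulr_ge0; last exact: ltW.
      by apply: mulr_ge0; [rewrite ler0n | exact: sqr_ge0].
    rewrite mulrA; apply: le_trans (ler_wpM2l k0 TM) _.
    rewrite mulr_sumr; apply: ler_sum => i _; rewrite mulr_sumr.
    by apply: ler_sum => j _; rewrite !mulrA.
  rewrite {1}g2 /T /B !mulr_sumr -big_split -sumrB /=.
  apply: ler_sum => i _; rewrite !mulr_sumr -big_split -sumrB /=.
  apply: ler_sum => j _.
  have -> : g ^+ 2 * (w i * w j * K i j ^+ 4) =
      ((g * (t i * t j)) ^+ 2)^-1 * `|K i j| ^+ 4.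
    have -> : `|K i j| ^+ 4 = K i j ^+ 4.
      by rewrite -[4%N]/(2 * 2)%N !exprM real_normK ?num_real.
    rewrite /w [LHS]mulrA; congr (_ * _).
    have [->|ti] := eqVneq (t i) 0.
      by rewrite !(mul0r, mulr0, expr0n) /= !(mulr0, mul0r, invr0).
    have [->|tj] := eqVneq (t j) 0.
      by rewrite !(mulr0, expr0n) /= !(mulr0, invr0).
    by field; rewrite ti tj gt_eqF.
  rewrite -[K i j ^+ 2](real_normK (num_real _)).
  by apply: quartic_majorant; rewrite ?normr_ge0 ?Kij.
move=> main.
have T0 : 0 < T by have := exprn_gt0 2 g0; nra.
have {}Bge : 3 * s <= r%:R * (s ^+ 3 * B).
  have rr : 0 < r%:R * (r%:R + 2) :> R by nra.
  move: Bge; rewrite ler_pdivrMr // -s2 => Bge.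
  have := ler_wpM2l (ltW s0) Bge; lra.
have key :
    g ^+ 2 * (r%:R * (s + 2) - 3 * s) <= r%:R * T * (r%:R * (s + 2) - 3 * s).
  have [r_le1|r2] := leqP r 1.
    (* In dimension one the factor is negative, but [T] is [g ^+ 2]. *)
    have r_1 : r = 1%N by apply/eqP; rewrite eqn_leq r_le1.
    move: gT; rewrite r_1 !mul1r => gT.
    by have -> : T = g ^+ 2 by apply/eqP; rewrite eq_le Tg.
  apply: ler_wpM2r => //.
  have s_2 : 2 <= s.
    have : 2 <= r%:R :> R by rewrite (ler_nat _ 2).
    by move=> ?; rewrite leNgt; apply/negP => ?; nra.
  rewrite rE; nra.
have gs : g * (s + 1) <= (s - 1) * (s + 2).
  have c0 : 0 < 2 * r%:R * T * (s + 1) by rewrite !mulr_gt0 ?ltr0n // ltr_wpDr.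
  rewrite -(ler_pM2r c0).
  have rmain := ler_wpM2l (le_trans ler01 r1) main.
  have gB := ler_wpM2l (sqr_ge0 g) Bge.
  have -> : (s - 1) * (s + 2) * (2 * r%:R * T * (s + 1)) =
    r%:R * T * (r%:R * (s + 2) - 3 * s) +
    r%:R * ((s * (1 + s) ^+ 2 + 2 * s) * T).
    by rewrite rE; ring.
  lra.
have s1 : 1 < s by rewrite ltNge; apply/negP => ?; nra.
rewrite rE ler_pdivlMr; last by nra.
have := ler_wpM2r (_ : 0 <= s - 1) gs; rewrite subr_ge0 ltW // => /(_ isT); lra.
Qed.

Lemma weighted_norm1_le (R : realType) (n r : nat) (t : 'I_n -> R)
    (Q : 'M[R]_n) :
  (0 < r)%N -> \sum_i t i ^+ 2 = 1 -> proj_le r Q ->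
  \sum_i \sum_j `|t i * t j * Q i j| <=
    ((r%:R - 1) * Num.sqrt (r%:R + 2) + 2) / (r%:R + 1).
Proof.
move=> r0 t1 Qr.
have n0 : (0 < n)%N.
  case: n t t1 {Q Qr} => // t; rewrite big_ord0 => /eqP.
  by rewrite eq_sym oner_eq0.
have [u [P [u0 u1 Pr umax]]] := extremal_pair R r n0.
apply: le_trans (umax _ _ t1 Qr) _; move: {t t1 Q Qr} umax.
set g := \sum_i _ => umax.
have [g_le0|g0] := leP g 0.
  apply: le_trans g_le0 _.
  rewrite divr_ge0 ?addr_ge0 // mulr_ge0 ?sqrtr_ge0 //.
  by rewrite subr_ge0 ler1n.
have [Ps PP _] := Pr.
have PC i j : P i j = P j i by rewrite -[in LHS]Ps mxE.
pose M : 'M[R]_n := \matrix_(i, j) (u i * u j * (-1) ^+ (P i j < 0)%R).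
have Ms : M^T = M by apply/matrixP => i j; rewrite !mxE PC (mulrC (u i)).
have MP i j : M i j * P j i = u i * u j * `|P i j|.
  by rewrite mxE (PC j i) -mulrA normrEsign.
have trMP : \tr (M *m P) = g.
  by apply: eq_bigr => i _; rewrite mxE; apply: eq_bigr => j _; rewrite MP.
have Mu i j : `|M i j| <= u i * u j.
  by rewrite mxE normrM normr_sign mulr1 ger0_norm // mulr_ge0.
have Mmax Q' : proj_le r Q' -> \tr (M *m Q') <= \tr (M *m P).
  move=> Q'r; rewrite trMP; apply: le_trans (umax _ _ u1 Q'r).
  have [Q's _ _] := Q'r.
  apply: ler_sum => i _; rewrite mxE; apply: ler_sum => j _.
  rewrite -[in leLHS]Q's [Q'^T _ _]mxE (le_trans (ler_norm _)) //.
  rewrite !normrM ler_wpM2r //.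
  by rewrite -normrM (le_trans (Mu i j)) // ler_norm.
have [PM psd] := ky_fan_max Ms Pr Mmax.
have KP : M *m P *m P = M *m P by rewrite -mulmxA PP.
have Kdiag i : (M *m P) i i = g * u i ^+ 2.
  pose B : 'M[R]_n := \matrix_(i, j) `|P i j|.
  have Bs : B^T = B by apply/matrixP => a b; rewrite !mxE PC.
  have dE x : dotr (x *m B) x = \sum_a \sum_b x 0 a * x 0 b * `|P a b|.
    rewrite dotrE exchange_big; apply: eq_bigr => b _ /=.
    by rewrite mxE mulr_suml; apply: eq_bigr => a _; rewrite mxE mulrAC.
  have gE : dotr ((\row_a u a) *m B) (\row_a u a) = g.
    by rewrite dE; apply: eq_bigr => a _; apply: eq_bigr => b _; rewrite !mxE.
  have ray x : dotr (x *m B) x <= g * dotr x x.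
    have [->|x0] := eqVneq x 0; first by rewrite mul0mx /dotr !mul0mx mxE mulr0.
    have xx : 0 < dotr x x by rewrite dotr_gt0.
    pose y := (Num.sqrt (dotr x x))^-1 *: x.
    have xE : x = Num.sqrt (dotr x x) *: y.
      by rewrite scalerA divff ?scale1r // gt_eqF // sqrtr_gt0.
    have y1 : \sum_a y 0 a ^+ 2 = 1.
      rewrite -[LHS]dotrE dotrZ exprVn sqr_sqrtr ?mulVf ?gt_eqF //.
      exact: ltW.
    rewrite [in leLHS]xE -scalemxAl dotrZl dotrZr mulrA -expr2.
    rewrite sqr_sqrtr ?(ltW xx) //.
    rewrite [leLHS]mulrC (ler_pM2r xx); apply: le_trans (umax _ _ y1 Pr).
    rewrite dE; apply: ler_sum => a _; apply: ler_sum => b _.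
    by rewrite normrM ler_wpM2r // ler_norm.
  have u1' : dotr (\row_a u a) (\row_a u a) = 1.
    by rewrite dotrE -[RHS]u1; apply: eq_bigr => a _; rewrite mxE.
  have /rowP/(_ i) := rayleigh_max Bs u1' gE ray; rewrite !mxE => ui.
  rewrite expr2 mulrA -ui mulr_suml; apply: eq_bigr => j _.
  by rewrite MP !mxE PC; ring.
apply: (@gramian_bound _ n r g u M (M *m P) P) => //.
- by rewrite trmx_mul Ms Ps.
- by rewrite -[RHS]mulmxA [P *m _]mulmxA PM KP.
Qed.

Lemma gammaN_le (R : realType) (n r : nat) : (0 < r <= n)%N ->
  gammaN R n r <= ((r%:R - 1) * Num.sqrt (r%:R + 2) + 2) / (r%:R + 1).
Proof.
move=> /andP[r0 rn]; have n0 : (0 < n)%N by apply: leq_trans rn.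
have n0R : 0 < n%:R :> R by rewrite ltr0n.
rewrite /gammaN ler_pdivrMl //.
apply: ge_sup => [|_ [Q Qr <-]]; first by case: (gammaN_has_sup R rn).
have [Qs QQ _] := Qr.
pose t (i : 'I_n) : R := (Num.sqrt n%:R)^-1.
have tt i j : t i * t j = n%:R^-1.
  by rewrite /t -invfM -expr2 sqr_sqrtr // ltW.
have t1 : \sum_i t i ^+ 2 = 1.
  under eq_bigr do rewrite expr2 tt.
  by rewrite sumr_const card_ord -[LHS]mulr_natr mulVf // gt_eqF.
have Qle : proj_le r Q by split=> //; rewrite (mxtrace_orthoproj Qr).
rewrite -ler_pdivrMl //; apply: le_trans (weighted_norm1_le r0 t1 Qle).
rewrite /norm1 mulr_sumr; apply: ler_sum => i _.
rewrite mulr_sumr; apply: ler_sum => j _.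
by rewrite tt normrM gtr0_norm // invr_gt0.
Qed.

Lemma gamma_le (R : realType) (r : nat) : (0 < r)%N ->
  gamma R r <= ((r%:R - 1) * Num.sqrt (r%:R + 2) + 2) / (r%:R + 1).
Proof.
move=> r0; apply: ge_sup => [|_ [n /= rn <-]]; first by case: (gamma_has_sup R r).
by apply: gammaN_le; rewrite r0.
Qed.

Lemma norm1_le_gamma (R : realType) (n r : nat) (Q : 'M[R]_n) :
  (0 < r <= n)%N -> orthoproj R r n Q -> norm1 Q <= n%:R * gamma R r.
Proof.
move=> /andP[r0 rn] Qr; have n0 : 0 < n%:R :> R.
  by rewrite ltr0n (leq_trans r0).
apply: (@le_trans _ _ (n%:R * gammaN R n r)).
  rewrite /gammaN mulVKf ?gt_eqF //.
  by apply: sup_upper_bound; [exact: gammaN_has_sup | exists Q].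
rewrite ler_pM2l //.
by apply: sup_upper_bound; [exact: gamma_has_sup | exists n].
Qed.

(** * The theorem *)

Theorem theorem2p1 (R : realType) :
  (forall k n : nat, (2 <= k <= n)%N ->
     forall G : sgraph, #|G| = n ->
       lambda R k G <= gamma R (k - 1)%N / (2 * (k%:R - 1)) * n%:R - 1 /\
       gamma R (k - 1)%N / (2 * (k%:R - 1)) * n%:R - 1 <=
         ((k%:R - 2) * Num.sqrt (k%:R + 1) + 2) / (2 * k%:R * (k%:R - 1))
           * n%:R - 1) /\
  (forall k : nat, (2 <= k)%N ->
     c_ R k <=
       ((k%:R - 2) * Num.sqrt (k%:R + 1) + 2) / (2 * k%:R * (k%:R - 1))).
Proof.
have bounds (k n : nat) : (2 <= k <= n)%N -> forall G : sgraph, #|G| = n ->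
    lambda R k G <= gamma R (k - 1)%N / (2 * (k%:R - 1)) * n%:R - 1 /\
    gamma R (k - 1)%N / (2 * (k%:R - 1)) * n%:R - 1 <=
      ((k%:R - 2) * Num.sqrt (k%:R + 1) + 2) / (2 * k%:R * (k%:R - 1))
        * n%:R - 1.
  case: k => [|r] //; rewrite ltnS => /andP[r0 rn] G Gn; rewrite -{}Gn in rn *.
  rewrite subSS subn0 -[r.+1]addn1 natrD addrK.
  have r0R : 0 < r%:R :> R by rewrite ltr0n.
  have n0 : 0 <= #|G|%:R :> R by [].
  split.
    have [Q Qr] := lambda_le_norm1 R rn.
    have : norm1 Q <= #|G|%:R * gamma R r.
      by apply: norm1_le_gamma; rewrite // r0 ltnW.
    rewrite -addn1 => Qg lamQ.
    rewrite lerBrDr -(ler_pM2l r0R) (le_trans lamQ) //.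
    have -> : r%:R * (gamma R r / (2 * r%:R) * #|G|%:R) =
      2^-1 * (#|G|%:R * gamma R r).
      by field; rewrite gt_eqF.
    by rewrite ler_pM2l // invr_gt0.
  rewrite lerD2r ler_wpM2r //.
  have -> : (r%:R + 1 - 2 : R) = r%:R - 1 by ring.
  have -> : (r%:R + 1 + 1 : R) = r%:R + 2 by ring.
  rewrite ler_pdivrMr; last by rewrite mulr_gt0.
  apply: le_trans (gamma_le R r0) _.
  rewrite le_eqVlt; apply/orP; left; apply/eqP; field.
  by rewrite !gt_eqF ?ltr_wpDl.
split=> // k k2; apply: ge_sup => [|_ [G [kG ->]]].
  by case: (c_has_sup R k).
have [b1 b2] := bounds k #|G| (introT andP (conj k2 kG)) G erefl.
have n0 : 0 < #|G|%:R :> R by rewrite ltr0n (leq_trans _ kG) // ltnW.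
by rewrite ler_pdivrMr // (le_trans b1) // (le_trans b2) // gerBl.
Qed.
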